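(* Let $S$ and $R=S/I$ be Noetherian rings, and suppose that $R$ has an $S$-free resolution by finitely generated free modules $$\mathbb E:\quad S\xleftarrow{\ \partial_1\ }E_1\longleftarrow\cdots\longleftarrow E_{c-1}\xleftarrow{\ \partial_c\ }E_c\longleftarrow 0$$ with $\partial_c\cong\partial_1^*$. Let $M$ be an $R$-module and let $(\mathbb K,\delta)$ be an $S$-free resolution of $M$. If $\sigma^M:\mathbb E\otimes_S\mathbb K\to\mathbb K$ is a map of complexes with components $$\sigma^M_{i,j}:E_i\otimes K_j\to K_{i+j}$$ that induces the multiplication map $R\otimes M\to M$, then the maps $$R\otimes\sigma^M_{c,j}:\ R\otimes K_j\longrightarrow R\otimes K_{c+j},\qquad j\ge0,$$ form a map of complexes from $R\otimes\mathbb K$ to $R\otimes \mathbb K$ shifted by $c$ (so that $R\otimes K_0$ maps to $R\otimes K_c$), and this map of complexes induces an isomorphism $$M=H_0(R\otimes\mathbb K)\longrightarrow H_c(R\otimes\mathbb K)=\mathrm{Tor}_c^S(R,M).$$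
   Context: Rings are commutative. Tensor products are over $S$, $E_0=S$, and $(-)^*=\mathrm{Hom}_S(-,S)$. The condition $\partial_c\cong\partial_1^*$ means that there are isomorphisms $E_c\cong E_0^*=S$ and $E_{c-1}\cong E_1^*$ under which $\partial_c$ corresponds to $\partial_1^*:E_0^*\to E_1^*$. The isomorphism $E_c\cong S$ is used to identify $E_c\otimes K_j$ with $K_j$, so $\sigma^M_{c,j}$ is regarded as a map $K_j\to K_{c+j}$. That $\sigma^M$ induces the multiplication map $R\otimes M\to M$ means that the map on $H_0$, namely $H_0(\mathbb E\otimes\mathbb K)=R\otimes M\to H_0(\mathbb K)=M$, is $r\otimes m\mapsto rm$. Maps of complexes into a shift by $c$ are understood with the usual sign convention (the maps commute with the differentials $R\otimes\delta$ up to the sign $(-1)^c$). *)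

(* Defs.v *)
From HB Require Import structures.
From mathcomp Require Import all_boot all_order all_algebra.
From mathcomp Require Import boolp.

Set Implicit Arguments.
Unset Strict Implicit.
Unset Printing Implicit Defensive.

Import GRing.Theory.
Local Open Scope ring_scope.
Local Open Scope quotient_scope.

Section LinearMaps.
Variables (S : pzRingType) (A B : lmodType S).

Definition mklin (f : A -> B) (hf : linear f) : {linear A -> B} :=
  HB.pack f (GRing.isLinear.Build S A B *:%R f hf).

Lemma lin_ext (f g : {linear A -> B}) : f =1 g -> f = g.
Proof.
case: f g => [f [[pf] [qf]]] [g [[pg] [qg]]] /= efg.
have {}efg : f = g by apply/funext.
by subst g; rewrite (Prop_irrelevance pf pg) (Prop_irrelevance qf qg).
Qed.

Record lin_iso := LinIso {
  fwd :> {linear A -> B};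
  bwd : {linear B -> A};
  fwdK : cancel fwd bwd;
  bwdK : cancel bwd fwd
}.

End LinearMaps.

Section Hom.
Variables (S : comPzRingType) (A B : lmodType S).

Definition Hom : Type := {linear A -> B}.
HB.instance Definition _ := gen_eqMixin Hom.
HB.instance Definition _ := gen_choiceMixin Hom.

Definition hom_zero : Hom := \0.
Definition hom_add (f g : Hom) : Hom := f \+ g.
Definition hom_opp (f : Hom) : Hom := \- f.
Definition hom_scale (a : S) (f : Hom) : Hom := a \*: f.

Fact hom_addA : associative hom_add.
Proof. by move=> f g h; apply: lin_ext => x; rewrite /= addrA. Qed.
Fact hom_addC : commutative hom_add.
Proof. by move=> f g; apply: lin_ext => x; rewrite /= addrC. Qed.
Fact hom_add0 : left_id hom_zero hom_add.
Proof. by move=> f; apply: lin_ext => x; rewrite /= add0r. Qed.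
Fact hom_addN : left_inverse hom_zero hom_opp hom_add.
Proof. by move=> f; apply: lin_ext => x; rewrite /= addNr. Qed.
HB.instance Definition _ :=
  GRing.isZmodule.Build Hom hom_addA hom_addC hom_add0 hom_addN.

Fact hom_scaleA a b f : hom_scale a (hom_scale b f) = hom_scale (a * b) f.
Proof. by apply: lin_ext => x; rewrite /= scalerA. Qed.
Fact hom_scale1 : left_id 1 hom_scale.
Proof. by move=> f; apply: lin_ext => x; rewrite /= scale1r. Qed.
Fact hom_scaleDr : right_distributive hom_scale +%R.
Proof. by move=> a f g; apply: lin_ext => x; rewrite /= scalerDr. Qed.
Fact hom_scaleDl f : {morph hom_scale^~ f : a b / a + b}.
Proof. by move=> a b; apply: lin_ext => x; rewrite /= scalerDl. Qed.
HB.instance Definition _ :=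
  GRing.Zmodule_isLmodule.Build S Hom
    hom_scaleA hom_scale1 hom_scaleDr hom_scaleDl.

End Hom.

Definition dual (S : comPzRingType) (A : lmodType S) : lmodType S := Hom A S^o.

Section DualMap.
Variables (S : comPzRingType) (A B : lmodType S) (f : {linear A -> B}).

Fact dual_map_linear :
  linear (fun u : dual B => (u : {linear B -> S^o}) \o f : dual A).
Proof. by move=> a u v; apply: lin_ext. Qed.
Definition dual_map : {linear dual B -> dual A} := mklin dual_map_linear.
End DualMap.

(* Quotients by submodules.  Since membership in a [submodClosed] predicate is *)
(* a boolean, classical logic is what makes every submodule of this form.     *)
Section Quotient.
Variables (S : pzRingType) (A : lmodType S) (I : submodClosed A).

Definition subm : {pred A} := fun x => x \in I.
Fact subm_zmod_closed : zmod_closed subm.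
Proof.
split=> [|x y xI yI]; first exact: (rpred0 I).
by rewrite -scaleN1r; apply: rpredD => //; apply: rpredZ.
Qed.
HB.instance Definition _ := GRing.isZmodClosed.Build A subm subm_zmod_closed.

Definition quotm : Type := Quotient.quot subm.
HB.instance Definition _ := GRing.Zmodule.on quotm.

Definition qproj (x : A) : quotm := \pi_(Quotient.quot subm) x.

Fact qproj_eq x y : (qproj x = qproj y) <-> (x - y \in I).
Proof.
rewrite /qproj; split=> [/eqP|h]; last apply/eqP.
  by rewrite -Quotient.idealrBE.
by rewrite -Quotient.idealrBE.
Qed.

Fact qproj_repr (x : quotm) : qproj (repr x) = x.
Proof. exact: reprK. Qed.

Definition qscale (a : S) (x : quotm) : quotm := qproj (a *: repr x).

Fact qprojD x y : qproj (x + y) = qproj x + qproj y.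
Proof. by rewrite /qproj raddfD. Qed.

Fact qscaleE a x : qscale a (qproj x) = qproj (a *: x).
Proof.
apply/qproj_eq; rewrite -scalerBr; apply: rpredZ.
by apply/qproj_eq; rewrite qproj_repr.
Qed.

Fact qscaleA a b x : qscale a (qscale b x) = qscale (a * b) x.
Proof. by rewrite -[x]qproj_repr !qscaleE scalerA. Qed.
Fact qscale1 : left_id 1 qscale.
Proof. by move=> x; rewrite -[x]qproj_repr qscaleE scale1r. Qed.
Fact qscaleDr : right_distributive qscale +%R.
Proof.
move=> a x y; rewrite -[x]qproj_repr -[y]qproj_repr -qprojD !qscaleE.
by rewrite scalerDr qprojD.
Qed.
Fact qscaleDl x : {morph qscale^~ x : a b / a + b}.
Proof. by move=> a b; rewrite -[x]qproj_repr !qscaleE scalerDl qprojD. Qed.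
HB.instance Definition _ := GRing.Zmodule_isLmodule.Build S quotm
  qscaleA qscale1 qscaleDr qscaleDl.

Fact qproj_linear : linear qproj.
Proof. by move=> a x y; rewrite qprojD -qscaleE. Qed.
HB.instance Definition _ := GRing.isLinear.Build S A quotm *:%R qproj qproj_linear.

Section Lift.
Variables (B : lmodType S) (f : {linear A -> B}).
Hypothesis f0 : forall x, x \in I -> f x = 0.

Fact qliftE x : f (repr (qproj x)) = f x.
Proof.
apply/eqP; rewrite -subr_eq0 -linearB f0 //.
by apply/qproj_eq; rewrite qproj_repr.
Qed.
Fact qlift_linear : linear (fun x : quotm => f (repr x)).
Proof.
move=> a x y; rewrite -[x]qproj_repr -[y]qproj_repr -linearP !qliftE.
by rewrite linearP.
Qed.
Definition qlift : {linear quotm -> B} := mklin qlift_linear.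
End Lift.

End Quotient.

(* Ideals of S are the submodules of S^o; the ideal may be the whole ring, in *)
(* which case S / I is the zero ring.                                         *)
Notation ideal S := (submodClosed (S^o)).

Section QuotientRing.
Variables (S : comPzRingType) (I : ideal S).

Definition quotr : Type := quotm I.
HB.instance Definition _ := GRing.Zmodule.on quotr.

Definition rproj (x : S) : quotr := qproj I (x : S^o).
Definition rrepr (x : quotr) : S := repr (x : quotm I).
Definition rone : quotr := rproj 1.
Definition rmul (x y : quotr) : quotr := rproj (rrepr x * rrepr y).

Fact rprojK x : rproj (rrepr x) = x. Proof. exact: qproj_repr. Qed.
Fact rprojD x y : rproj (x + y) = rproj x + rproj y.
Proof. exact: qprojD. Qed.
Fact rmulE x y : rmul (rproj x) (rproj y) = rproj (x * y).
Proof.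
have mulI (z : S) (w : S^o) : w \in I -> ((z * w : S^o) \in I) by exact: rpredZ.
have diffI z : (rrepr (rproj z) - z : S^o) \in I.
  by apply/qproj_eq; exact: rprojK.
apply/qproj_eq.
have -> : (rrepr (rproj x) * rrepr (rproj y) : S^o) - x * y
       = (rrepr (rproj x) * (rrepr (rproj y) - y) : S^o)
         + y * (rrepr (rproj x) - x).
  by rewrite !mulrBr addrA (mulrC y) subrK (mulrC y).
by apply: rpredD; apply: mulI.
Qed.

Fact rmulA : associative rmul.
Proof.
by move=> x y z; rewrite -[x]rprojK -[y]rprojK -[z]rprojK !rmulE mulrA.
Qed.
Fact rmulC : commutative rmul.
Proof. by move=> x y; rewrite -[x]rprojK -[y]rprojK !rmulE mulrC. Qed.
Fact rmul1 : left_id rone rmul.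
Proof. by move=> x; rewrite -[x]rprojK rmulE mul1r. Qed.
Fact rmulDl : left_distributive rmul +%R.
Proof.
move=> x y z; rewrite -[x]rprojK -[y]rprojK -[z]rprojK -rprojD !rmulE.
by rewrite mulrDl rprojD.
Qed.
HB.instance Definition _ :=
  GRing.Zmodule_isComPzRing.Build quotr rmulA rmulC rmul1 rmulDl.

Fact rproj_zmod_morphism : zmod_morphism rproj.
Proof. by move=> x y; exact: (raddfB (qproj I)). Qed.
HB.instance Definition _ :=
  GRing.isZmodMorphism.Build S quotr rproj rproj_zmod_morphism.
Fact rproj_monoid_morphism : monoid_morphism rproj.
Proof. by split=> // x y; rewrite -rmulE. Qed.
HB.instance Definition _ :=
  GRing.isMonoidMorphism.Build S quotr rproj rproj_monoid_morphism.

End QuotientRing.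

Definition noetherian (S : comPzRingType) : Prop :=
  forall J : ideal S, exists (k : nat) (g : 'I_k -> S),
    forall x : S^o, x \in J <-> exists a : 'I_k -> S, x = \sum_i a i * g i.

Definition restr (S R : comPzRingType) (f : {rmorphism S -> R})
  (M : lmodType R) : Type := M.

Section Restriction.
Variables (S R : comPzRingType) (f : {rmorphism S -> R}) (M : lmodType R).
Local Notation restr := (restr f M).

HB.instance Definition _ := GRing.Zmodule.on restr.

Definition restr_scale (a : S) (m : restr) : restr := f a *: (m : M).
Fact restr_scaleA a b m : restr_scale a (restr_scale b m) = restr_scale (a * b) m.
Proof. by rewrite /restr_scale scalerA rmorphM. Qed.
Fact restr_scale1 : left_id 1 restr_scale.
Proof. by move=> m; rewrite /restr_scale rmorph1 scale1r. Qed.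
Fact restr_scaleDr : right_distributive restr_scale +%R.
Proof. by move=> a m n; exact: scalerDr. Qed.
Fact restr_scaleDl m : {morph restr_scale^~ m : a b / a + b}.
Proof. by move=> a b; rewrite /restr_scale rmorphD scalerDl. Qed.
HB.instance Definition _ := GRing.Zmodule_isLmodule.Build S restr
  restr_scaleA restr_scale1 restr_scaleDr restr_scaleDl.

End Restriction.

Section Free.
Variables (S : pzRingType) (A : lmodType S).

Definition is_basis (X : choiceType) (b : X -> A) : Prop :=
  (forall a : A, exists (s : seq X) (k : X -> S), a = \sum_(x <- s) k x *: b x)
  /\ (forall (s : seq X) (k : X -> S), uniq s ->
        \sum_(x <- s) k x *: b x = 0 -> forall x, x \in s -> k x = 0).

Definition is_free : Prop := exists (X : choiceType) (b : X -> A), is_basis b.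
Definition is_finite_free : Prop :=
  exists (X : finType) (b : X -> A), is_basis b.

End Free.

(* Tensor product: formal sums of pairs, modulo the congruence generated by   *)
(* bilinearity.  No formal coefficients are needed, as s(a ⊗ b) = (s a) ⊗ b.  *)
Section Tensor.
Variables (S : comPzRingType) (A B : lmodType S).

Inductive tensor_rel : seq (A * B) -> seq (A * B) -> Prop :=
| tensor_refl s : tensor_rel s s
| tensor_sym s t : tensor_rel s t -> tensor_rel t s
| tensor_trans s t u : tensor_rel s t -> tensor_rel t u -> tensor_rel s u
| tensor_cat s s' t t' :
    tensor_rel s s' -> tensor_rel t t' -> tensor_rel (s ++ t) (s' ++ t')
| tensor_comm s t : tensor_rel (s ++ t) (t ++ s)
| tensor_zero b : tensor_rel [:: (0, b)] [::]
| tensor_addl a a' b : tensor_rel [:: (a + a', b)] [:: (a, b); (a', b)]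
| tensor_addr a b b' : tensor_rel [:: (a, b + b')] [:: (a, b); (a, b')]
| tensor_scale k a b : tensor_rel [:: (k *: a, b)] [:: (a, k *: b)].

Definition tensor_relb : rel (seq (A * B)) := fun s t => `[< tensor_rel s t >].
Fact tensor_equiv : equiv_class_of tensor_relb.
Proof.
split=> [s|s t|t s u].
- by apply/asboolP; exact: tensor_refl.
- by apply/idP/idP=> /asboolP h; apply/asboolP; exact: tensor_sym.
- by move=> /asboolP h1 /asboolP h2; apply/asboolP; exact: tensor_trans h1 h2.
Qed.
Canonical tensor_equiv_rel := EquivRelPack tensor_equiv.
Canonical tensor_encModRel := defaultEncModRel tensor_relb.

Definition tensor : Type := {eq_quot tensor_relb}.
HB.instance Definition _ := EqQuotient.on tensor.
HB.instance Definition _ := Choice.on tensor.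

Definition tclass (s : seq (A * B)) : tensor := \pi_tensor s.
Definition trepr (x : tensor) : seq (A * B) := repr x.
Definition pure (a : A) (b : B) : tensor := tclass [:: (a, b)].

Fact tclass_eq s t : tclass s = tclass t <-> tensor_rel s t.
Proof.
rewrite /tclass; split=> [/eqP|h].
  by rewrite eqmodE => /asboolP.
by apply/eqP; rewrite eqmodE; apply/asboolP.
Qed.
Fact treprK x : tclass (trepr x) = x. Proof. exact: reprK. Qed.
Fact trepr_rel s : tensor_rel (trepr (tclass s)) s.
Proof. by apply/tclass_eq; exact: treprK. Qed.

Definition tmap (k : S) (s : seq (A * B)) := [seq (k *: p.1, p.2) | p <- s].

Fact tmap_rel k s t : tensor_rel s t -> tensor_rel (tmap k s) (tmap k t).
Proof.
elim=> {s t} [s|s t _|s t u _ h1 _ h2|s s' t t' _ h1 _ h2|s t|b|a a' b|a b b'|l a b].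
- exact: tensor_refl.
- exact: tensor_sym.
- exact: tensor_trans h1 h2.
- by rewrite /tmap !map_cat; exact: tensor_cat.
- by rewrite /tmap !map_cat; exact: tensor_comm.
- by rewrite /= scaler0; exact: tensor_zero.
- by rewrite /= scalerDr; exact: tensor_addl.
- exact: tensor_addr.
- by rewrite /= scalerA mulrC -scalerA; exact: tensor_scale.
Qed.

Definition tzero : tensor := tclass [::].
Definition tadd (x y : tensor) : tensor := tclass (trepr x ++ trepr y).
Definition tscale (k : S) (x : tensor) : tensor := tclass (tmap k (trepr x)).
Definition topp (x : tensor) : tensor := tscale (-1) x.

Fact taddE s t : tadd (tclass s) (tclass t) = tclass (s ++ t).
Proof. by apply/tclass_eq; apply: tensor_cat; exact: trepr_rel. Qed.
Fact tscaleE k s : tscale k (tclass s) = tclass (tmap k s).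
Proof. by apply/tclass_eq; apply: tmap_rel; exact: trepr_rel. Qed.

Fact taddA : associative tadd.
Proof.
move=> x y z; rewrite -[x]treprK -[y]treprK -[z]treprK !taddE.
by rewrite catA.
Qed.
Fact taddC : commutative tadd.
Proof.
move=> x y; rewrite -[x]treprK -[y]treprK !taddE.
by apply/tclass_eq; exact: tensor_comm.
Qed.
Fact tadd0 : left_id tzero tadd.
Proof. by move=> x; rewrite -[x]treprK taddE. Qed.

Fact tscale_addl_rel k l s :
  tensor_rel (tmap (k + l) s) (tmap k s ++ tmap l s).
Proof.
elim: s => [|[a b] s IH]; first exact: tensor_refl.
apply: (@tensor_trans _ ([:: (k *: a, b); (l *: a, b)] ++ tmap k s ++ tmap l s)).
  by rewrite /= scalerDl; exact: (tensor_cat (tensor_addl _ _ _) IH).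
apply: (tensor_cat (tensor_refl [:: (k *: a, b)])).
have := tensor_cat (tensor_comm [:: (l *: a, b)] (tmap k s))
                   (tensor_refl (tmap l s)).
by rewrite -!catA.
Qed.
Fact tmap0_rel s : tensor_rel (tmap 0 s) [::].
Proof.
elim: s => [|[a b] s IH]; first exact: tensor_refl.
rewrite /= scale0r -cat1s -[[::]]/([::] ++ [::]).
by apply: tensor_cat => //; exact: tensor_zero.
Qed.

Fact tscaleA k l x : tscale k (tscale l x) = tscale (k * l) x.
Proof.
rewrite -[x]treprK !tscaleE; congr tclass.
by rewrite /tmap -map_comp; apply: eq_map => p /=; rewrite scalerA.
Qed.
Fact tscale1 : left_id 1 tscale.
Proof.
move=> x; rewrite -[x]treprK tscaleE; congr tclass.
by rewrite -[RHS]map_id; apply: eq_map => -[a b] /=; rewrite scale1r.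
Qed.
Fact tscaleDr : right_distributive tscale tadd.
Proof.
move=> k x y; rewrite -[x]treprK -[y]treprK !(taddE, tscaleE).
by rewrite /tmap map_cat.
Qed.
Fact tscaleDl x : {morph tscale^~ x : k l / k + l >-> tadd k l}.
Proof.
move=> k l; rewrite -[x]treprK !(taddE, tscaleE).
by apply/tclass_eq; exact: tscale_addl_rel.
Qed.
Fact taddN : left_inverse tzero topp tadd.
Proof.
move=> x; rewrite /topp -{2}[x]tscale1 -tscaleDl addNr -[x]treprK tscaleE.
by apply/tclass_eq; exact: tmap0_rel.
Qed.

HB.instance Definition _ := GRing.isZmodule.Build tensor taddA taddC tadd0 taddN.
HB.instance Definition _ := GRing.Zmodule_isLmodule.Build S tensor
  tscaleA tscale1 tscaleDr tscaleDl.

Fact pureDl a a' b : pure (a + a') b = pure a b + pure a' b.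
Proof.
by rewrite [RHS]taddE; apply/tclass_eq; exact: tensor_addl.
Qed.
Fact pureDr a b b' : pure a (b + b') = pure a b + pure a b'.
Proof.
by rewrite [RHS]taddE; apply/tclass_eq; exact: tensor_addr.
Qed.
Fact pureZl k a b : pure (k *: a) b = k *: pure a b.
Proof. by rewrite [RHS]tscaleE. Qed.
Fact pureZr k a b : pure a (k *: b) = k *: pure a b.
Proof. by rewrite -pureZl; apply/tclass_eq/tensor_sym/tensor_scale. Qed.

Fact tclassE s : tclass s = \sum_(p <- s) pure p.1 p.2.
Proof.
elim: s => [|[a b] s IH]; first by rewrite big_nil.
by rewrite big_cons -IH [RHS]taddE.
Qed.

Section Lift.
Variables (C : lmodType S) (f : A -> B -> C).
Hypothesis f_linl : forall b, linear (f^~ b).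
Hypothesis f_linr : forall a, linear (f a).

Definition lift_sum (s : seq (A * B)) : C := \sum_(p <- s) f p.1 p.2.

Fact lift_sum_rel s t : tensor_rel s t -> lift_sum s = lift_sum t.
Proof.
have L b : f 0 b = 0.
  have := f_linl b 1 0 0; rewrite !scale1r !addr0 => /eqP.
  by rewrite -subr_eq subrr eq_sym => /eqP.
elim=> {s t} [s|s t _|s t u _ h1 _ h2|s s' t t' _ h1 _ h2|s t|b|a a' b|a b b'|k a b] //.
- by rewrite h1.
- by rewrite /lift_sum !big_cat /= -/(lift_sum s) h1 -/(lift_sum t) h2.
- by rewrite /lift_sum !big_cat /= addrC.
- by rewrite /lift_sum big_seq1 big_nil /=.
- rewrite /lift_sum !big_cons !big_nil !addr0 /=.
  by have := f_linl b 1 a a'; rewrite !scale1r.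
- rewrite /lift_sum !big_cons !big_nil !addr0 /=.
  by have := f_linr a 1 b b'; rewrite !scale1r.
- rewrite /lift_sum !big_seq1 /=.
  have R : f a 0 = 0.
    have := f_linr a 1 0 0; rewrite !scale1r !addr0 => /eqP.
    by rewrite -subr_eq subrr eq_sym => /eqP.
  have := f_linl b k a 0; rewrite !addr0 L addr0 => ->.
  by have := f_linr a k b 0; rewrite !addr0 R addr0 => ->.
Qed.

Fact lift_linear : linear (fun x : tensor => lift_sum (trepr x)).
Proof.
have E s : lift_sum (trepr (tclass s)) = lift_sum s.
  exact/lift_sum_rel/trepr_rel.
move=> k x y; rewrite -[x]treprK -[y]treprK.
have -> : k *: tclass (trepr x) + tclass (trepr y)
          = tclass (tmap k (trepr x) ++ trepr y).
  by rewrite [k *: _]tscaleE [LHS]taddE.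
rewrite !E /lift_sum big_cat /=; congr (_ + _).
rewrite scaler_sumr big_map; apply: eq_bigr => p _ /=.
have := f_linl p.2 k p.1 0; rewrite addr0 => ->.
have := f_linl p.2 1 0 0; rewrite !scale1r !addr0 => /eqP.
by rewrite -subr_eq subrr eq_sym => /eqP ->; rewrite addr0.
Qed.

Definition tensor_lift : {linear tensor -> C} := mklin lift_linear.

Lemma tensor_liftE a b : tensor_lift (pure a b) = f a b.
Proof.
rewrite /= (lift_sum_rel (trepr_rel _)) /lift_sum big_seq1 //.
Qed.
End Lift.

Lemma tensor_ext (C : lmodType S) (f g : {linear tensor -> C}) :
  (forall a b, f (pure a b) = g (pure a b)) -> f =1 g.
Proof.
move=> fg x; rewrite -[x]treprK tclassE !linear_sum.
by apply: eq_bigr => p _; exact: fg.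
Qed.

Fact pure_linear_r a : linear (pure a).
Proof. by move=> k b b'; rewrite pureDr pureZr. Qed.
HB.instance Definition _ a :=
  GRing.isLinear.Build S B tensor *:%R (pure a) (pure_linear_r a).

End Tensor.

Notation "a ⊗ b" := (pure a b) (at level 40, left associativity) : ring_scope.

Section TensorMap.
Variables (S : comPzRingType) (A A' B B' : lmodType S).
Variables (f : {linear A -> A'}) (g : {linear B -> B'}).

Fact tensor_map_linl b : linear (fun a => f a ⊗ g b).
Proof. by move=> k a a'; rewrite linearP pureDl pureZl. Qed.
Fact tensor_map_linr a : linear (fun b => f a ⊗ g b).
Proof. by move=> k b b'; rewrite linearP pureDr pureZr. Qed.
Definition tensor_map : {linear tensor A B -> tensor A' B'} :=
  tensor_lift tensor_map_linl tensor_map_linr.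

Lemma tensor_mapE a b : tensor_map (a ⊗ b) = f a ⊗ g b.
Proof. exact: tensor_liftE. Qed.
End TensorMap.

Lemma tensor_map_comp (S : comPzRingType) (A A' A'' B B' B'' : lmodType S)
    (f : {linear A -> A'}) (f' : {linear A' -> A''})
    (g : {linear B -> B'}) (g' : {linear B' -> B''}) t :
  tensor_map f' g' (tensor_map f g t) = tensor_map (f' \o f) (g' \o g) t.
Proof.
pose h : {linear tensor A B -> tensor A'' B''} :=
  tensor_map f' g' \o tensor_map f g.
apply: (tensor_ext (f := h)) t => a b.
have -> : h (a ⊗ b) = tensor_map f' g' (tensor_map f g (a ⊗ b)) by [].
by rewrite !tensor_mapE.
Qed.

Lemma tensor_map_ext (S : comPzRingType) (A A' B B' : lmodType S)
    (f f' : {linear A -> A'}) (g g' : {linear B -> B'}) :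
  f =1 f' -> g =1 g' -> tensor_map f g =1 tensor_map f' g'.
Proof. by move=> ef eg; apply: tensor_ext => a b; rewrite !tensor_mapE ef eg. Qed.

Lemma tensor_map0l (S : comPzRingType) (A A' B B' : lmodType S)
    (f : {linear A -> A'}) (g : {linear B -> B'}) t :
  (forall a, f a = 0) -> tensor_map f g t = 0.
Proof.
move=> f0; apply: (tensor_ext (g := \0)) t => a b.
by rewrite tensor_mapE f0 -(scale0r (0 : A')) pureZl scale0r.
Qed.

Lemma tensor_map0r (S : comPzRingType) (A A' B B' : lmodType S)
    (f : {linear A -> A'}) (g : {linear B -> B'}) t :
  (forall b, g b = 0) -> tensor_map f g t = 0.
Proof.
move=> g0; apply: (tensor_ext (g := \0)) t => a b.
by rewrite tensor_mapE g0 -(scale0r (0 : B')) pureZr scale0r.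
Qed.

(* Chain complexes C_0 <- C_1 <- C_2 <- ..., zero in negative degrees. *)
Record complex (S : pzRingType) := Complex {
  obj :> nat -> lmodType S;
  diff : forall i, {linear obj i.+1 -> obj i};
  diff_diff : forall i x, diff i (diff i.+1 x) = 0
}.

Section Homology.
Variables (S : pzRingType) (C : complex S).

(* The differential leaving degree n, which is zero for n = 0. *)
Definition diff_from (n : nat) : {linear C n -> C n.-1} :=
  match n return {linear C n -> C n.-1} with
  | 0 => \0
  | m.+1 => diff C m
  end.

Fact diff_from_diff n x : diff_from n (diff C n x) = 0.
Proof. by case: n x => [//|n] x; exact: diff_diff. Qed.

Variable n : nat.

Definition cycle_pred : {pred C n} := fun x => diff_from n x == 0.
Fact cycle_pred_closed : submod_closed cycle_pred.
Proof.
split=> [|a x y]; rewrite !unfold_in ?linear0 // linearP.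
by move=> /eqP -> /eqP ->; rewrite scaler0 addr0.
Qed.
HB.instance Definition _ :=
  GRing.isSubmodClosed.Build S (C n) cycle_pred cycle_pred_closed.

Record cycles := Cycle { cycle_val :> C n; cycleP : cycle_pred cycle_val }.
HB.instance Definition _ := [isSub of cycles for cycle_val].
HB.instance Definition _ := [Choice of cycles by <:].
HB.instance Definition _ := [SubChoice_isSubLmodule of cycles by <:].

Definition boundary_pred : {pred cycles} :=
  fun z => `[< exists y : C n.+1, diff C n y = cycle_val z >].
Fact boundary_pred_closed : submod_closed boundary_pred.
Proof.
split=> [|a x y]; first by apply/asboolP; exists 0; rewrite linear0.
move=> /asboolP[u hu] /asboolP[v hv]; apply/asboolP.
by exists (a *: u + v); rewrite linearP hu hv.
Qed.
HB.instance Definition _ :=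
  GRing.isSubmodClosed.Build S cycles boundary_pred boundary_pred_closed.

Definition homology : lmodType S := quotm boundary_pred.
Definition hclass : {linear cycles -> homology} := qproj boundary_pred.

End Homology.

Section HomologyLift.
Variables (S : pzRingType) (C : complex S) (n : nat) (B : lmodType S).
Variables (f : {linear C n -> B}) (f0 : forall y, f (diff C n y) = 0).

Fact homology_lift_linear : linear (fun z : cycles C n => f (cycle_val z)).
Proof. by move=> a x y; rewrite -linearP. Qed.
Fact homology_lift0 z : z \in boundary_pred (C := C) (n := n) ->
  mklin homology_lift_linear z = 0.
Proof. by move=> /asboolP[y hy]; rewrite /= -hy f0. Qed.
Definition homology_lift : {linear homology C n -> B} := qlift homology_lift0.
End HomologyLift.

Section HomologyMap.
Variables (S : pzRingType) (C D : complex S) (n m : nat).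
Variable g : {linear C n -> D m}.
Hypothesis g_cycle :
  forall x, diff_from C n x = 0 -> diff_from D m (g x) = 0.
Hypothesis g_boundary :
  forall y, exists z, diff D m z = g (diff C n y).

Fact hmap_cycle (z : cycles C n) : cycle_pred (g (cycle_val z)).
Proof. by apply/eqP/g_cycle/eqP; exact: (cycleP z). Qed.
Definition cycle_map (z : cycles C n) : cycles D m := Cycle (hmap_cycle z).
Fact hmap_linear : linear (fun z => hclass D m (cycle_map z)).
Proof.
move=> a x y; rewrite -linearP; congr (hclass D m _).
by apply: val_inj; rewrite /= linearP.
Qed.
Fact hmap0 z : z \in boundary_pred (C := C) (n := n) ->
  mklin hmap_linear z = 0.
Proof.
move=> /asboolP[y hy]; have [w hw] := g_boundary y.
rewrite /= -(linear0 (hclass D m)); apply/qproj_eq; rewrite subr0.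
by apply/asboolP; exists w; rewrite hw hy.
Qed.
Definition homology_map : {linear homology C n -> homology D m} := qlift hmap0.

Lemma homology_mapE z : homology_map (hclass C n z) = hclass D m (cycle_map z).
Proof. exact: (qliftE hmap0). Qed.
End HomologyMap.

Record chain_map (S : pzRingType) (C D : complex S) := ChainMap {
  cmap :> forall n, {linear C n -> D n};
  cmap_diff : forall n x, cmap n (diff C n x) = diff D n (cmap n.+1 x)
}.

Section ChainMapHomology.
Variables (S : pzRingType) (C D : complex S) (f : chain_map C D) (n : nat).

Fact chain_map_cycle x : diff_from C n x = 0 -> diff_from D n (f n x) = 0.
Proof. by case: n x => [//|k] x /= h; rewrite -cmap_diff h linear0. Qed.
Fact chain_map_boundary y : exists z, diff D n z = f n (diff C n y).
Proof. by exists (f n.+1 y); rewrite cmap_diff. Qed.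
Definition chain_homology_map : {linear homology C n -> homology D n} :=
  homology_map chain_map_cycle chain_map_boundary.
End ChainMapHomology.

(* Maps of complexes from C to D shifted by c, sending C_j to D_(j+c), with   *)
(* sign (-1)^c.  The shifted complex lives in degrees >= -c, so compatibility *)
(* with the differential in degree 0 says that C_0 lands in cycles of D_c.    *)
Record shift_map (S : pzRingType) (c : nat) (C D : complex S) := ShiftMap {
  smap :> forall j, {linear C j -> D (j + c)%N};
  smap_diff : forall j x,
    smap j (diff C j x) = (-1) ^+ c *: diff D (j + c) (smap j.+1 x);
  smap_diff0 : forall x, diff_from D c (smap 0 x) = 0
}.

Section ShiftMapHomology.
Variables (S : pzRingType) (c : nat) (C D : complex S) (f : shift_map c C D).

Fact shift_map_cycle x : diff_from C 0 x = 0 -> diff_from D c (f 0%N x) = 0.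
Proof. by move=> _; exact: smap_diff0. Qed.
Fact shift_map_boundary y : exists z, diff D c z = f 0%N (diff C 0 y).
Proof. by exists ((-1) ^+ c *: f 1%N y); rewrite linearZ smap_diff. Qed.
Definition shift_homology_map : {linear homology C 0 -> homology D c} :=
  homology_map (m := c) shift_map_cycle shift_map_boundary.
End ShiftMapHomology.

Record augmentation (S : pzRingType) (C : complex S) (N : lmodType S) :=
  Augmentation {
    aug :> {linear C 0%N -> N};
    aug_diff : forall x, aug (diff C 0 x) = 0
  }.

Definition aug_H0 (S : pzRingType) (C : complex S) (N : lmodType S)
  (eps : augmentation C N) : {linear homology C 0 -> N} :=
  homology_lift (aug_diff eps).

Section AugComp.
Variables (S : pzRingType) (C : complex S) (N P : lmodType S).
Variables (h : {linear N -> P}) (eps : augmentation C N).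
Fact aug_comp_diff x : (h \o aug eps) (diff C 0 x) = 0.
Proof. by rewrite /= aug_diff linear0. Qed.
Definition aug_comp : augmentation C P := Augmentation aug_comp_diff.
End AugComp.

Record is_resolution (S : pzRingType) (C : complex S) (N : lmodType S)
    (eps : augmentation C N) : Prop := IsResolution {
  aug_surj : forall y : N, exists x, eps x = y;
  aug_exact : forall x, eps x = 0 -> exists y, diff C 0 y = x;
  diff_exact : forall i x, diff C i x = 0 -> exists y, diff C i.+1 y = x
}.

Record is_free_resolution (S : pzRingType) (C : complex S) (N : lmodType S)
    (eps : augmentation C N) : Prop := IsFreeResolution {
  free_res_resolution : is_resolution eps;
  free_res_free : forall i, is_free (C i)
}.

(* The degree-n part of the tensor product of complexes, the direct sum of    *)
(* E_i ⊗ K_j over i + j = n, as families indexed by i, j and a proof of       *)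
(* i + j = n; there are finitely many such pairs.                             *)
Section TotalObject.
Variables (S : comPzRingType) (E K : nat -> lmodType S) (n : nat).

Definition tot_obj : Type := forall i j, (i + j)%N = n -> tensor (E i) (K j).
HB.instance Definition _ := gen_eqMixin tot_obj.
HB.instance Definition _ := gen_choiceMixin tot_obj.

Definition tot_zero : tot_obj := fun i j e => 0.
Definition tot_add (x y : tot_obj) : tot_obj := fun i j e => x i j e + y i j e.
Definition tot_opp (x : tot_obj) : tot_obj := fun i j e => - x i j e.
Definition tot_scale (a : S) (x : tot_obj) : tot_obj := fun i j e => a *: x i j e.

Fact tot_ext (x y : tot_obj) : (forall i j e, x i j e = y i j e) -> x = y.
Proof.
by move=> h; do 3 (apply: functional_extensionality_dep => ?); exact: h.
Qed.
Fact tot_addA : associative tot_add.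
Proof. by move=> x y z; apply: tot_ext => i j e; exact: addrA. Qed.
Fact tot_addC : commutative tot_add.
Proof. by move=> x y; apply: tot_ext => i j e; exact: addrC. Qed.
Fact tot_add0 : left_id tot_zero tot_add.
Proof. by move=> x; apply: tot_ext => i j e; exact: add0r. Qed.
Fact tot_addN : left_inverse tot_zero tot_opp tot_add.
Proof. by move=> x; apply: tot_ext => i j e; exact: addNr. Qed.
HB.instance Definition _ :=
  GRing.isZmodule.Build tot_obj tot_addA tot_addC tot_add0 tot_addN.

Fact tot_scaleA a b x : tot_scale a (tot_scale b x) = tot_scale (a * b) x.
Proof. by apply: tot_ext => i j e; exact: scalerA. Qed.
Fact tot_scale1 : left_id 1 tot_scale.
Proof. by move=> x; apply: tot_ext => i j e; exact: scale1r. Qed.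
Fact tot_scaleDr : right_distributive tot_scale +%R.
Proof. by move=> a x y; apply: tot_ext => i j e; exact: scalerDr. Qed.
Fact tot_scaleDl x : {morph tot_scale^~ x : a b / a + b}.
Proof. by move=> a b; apply: tot_ext => i j e; exact: scalerDl. Qed.
HB.instance Definition _ := GRing.Zmodule_isLmodule.Build S tot_obj
  tot_scaleA tot_scale1 tot_scaleDr tot_scaleDl.

Section Inclusion.
Variables i j : nat.

Definition tot_incl_fun (t : tensor (E i) (K j)) : tot_obj :=
  fun i' j' _ =>
    match i =P i', j =P j' with
    | ReflectT ei, ReflectT ej =>
        ecast k (tensor (E i') (K k)) ej (ecast k (tensor (E k) (K j)) ei t)
    | _, _ => 0
    end.
Fact tot_incl_linear : linear tot_incl_fun.
Proof.
move=> a x y; apply: tot_ext => i' j' e'.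
rewrite /GRing.add /GRing.scale /= /tot_add /tot_scale /tot_incl_fun.
case: eqP => [ei|_]; last by rewrite scaler0 addr0.
case: eqP => [ej|_]; last by rewrite scaler0 addr0.
by case: i' / ei e'; case: j' / ej.
Qed.
Definition tot_incl : {linear tensor (E i) (K j) -> tot_obj} :=
  mklin tot_incl_linear.

Lemma tot_incl_same t e' : tot_incl t i j e' = t.
Proof.
rewrite /= /tot_incl_fun; case: eqP => // ei; case: eqP => // ej.
by rewrite (eq_irrelevance ei erefl) (eq_irrelevance ej erefl).
Qed.
End Inclusion.

End TotalObject.

Section TensorComplex.
Variables (S : comPzRingType) (E K : complex S).

Fact totl n i j : (i + j)%N = n -> (i.+1 + j)%N = n.+1. Proof. by move=> <-. Qed.
Fact totr n i j : (i + j)%N = n -> (i + j.+1)%N = n.+1.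
Proof. by move=> <-; rewrite addnS. Qed.

(* d (x ⊗ y) = dx ⊗ y + (-1)^i x ⊗ dy  for x in E_i. *)
Definition tot_diff_fun n (x : tot_obj E K n.+1) : tot_obj E K n :=
  fun i j e =>
    tensor_map (diff E i) idfun (x i.+1 j (totl e))
    + (-1) ^+ i *: tensor_map idfun (diff K j) (x i j.+1 (totr e)).

Fact tot_diff_linear n : linear (@tot_diff_fun n).
Proof.
move=> a x y; apply: tot_ext => i j e.
have D k (u v : tot_obj E K k) l m h : (a *: u + v) l m h = a *: u l m h + v l m h.
  by [].
by rewrite D /tot_diff_fun !D !linearP !scalerDr !scalerA (mulrC a) addrACA.
Qed.
Definition tot_diff n : {linear tot_obj E K n.+1 -> tot_obj E K n} :=
  mklin (@tot_diff_linear n).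

Lemma tot_diffE n (x : tot_obj E K n.+1) i j (e : (i + j)%N = n) :
  tot_diff n x i j e =
    tensor_map (diff E i) idfun (x i.+1 j (totl e))
    + (-1) ^+ i *: tensor_map idfun (diff K j) (x i j.+1 (totr e)).
Proof. by []. Qed.

Fact tot_diff_diff n x : tot_diff n (tot_diff n.+1 x) = 0.
Proof.
apply: tot_ext => i j e; rewrite [RHS]/(0 : tensor (E i) (K j)).
rewrite tot_diffE !(tot_diffE (n := n.+1)) !linearD !linearZ_LR !tensor_map_comp.
rewrite [in X in X + _ + _]tensor_map0l ?add0r; last exact: diff_diff.
rewrite [in X in _ + (_ + X)]tensor_map0r; last exact: diff_diff.
rewrite (eq_irrelevance (totr (totl e)) (totl (totr e))).
set u := x _ _ _.
rewrite (tensor_map_ext (f' := diff E i) (g' := diff K j)) //.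
rewrite [in X in _ + X](tensor_map_ext (f' := diff E i) (g' := diff K j)) //.
rewrite exprS mulN1r scaleNr raddf0 scaler0 addr0; exact: addNr.
Qed.

Definition tensor_complex : complex S := Complex tot_diff_diff.

Section Augmentation.
Variables (A B : lmodType S) (eE : augmentation E A) (eK : augmentation K B).

Fact tensor_aug_linear : linear (fun x : tensor_complex 0%N =>
  tensor_map eE eK (x 0%N 0%N (erefl 0%N))).
Proof. by move=> a x y; rewrite -linearP. Qed.
Fact tensor_aug_diff x : mklin tensor_aug_linear (diff tensor_complex 0 x) = 0.
Proof.
have -> : mklin tensor_aug_linear (diff tensor_complex 0 x) =
  tensor_map eE eK (tot_diff 0 x 0%N 0%N (erefl 0%N)) by [].
rewrite tot_diffE linearD linearZ_LR !tensor_map_comp.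
rewrite [X in X + _]tensor_map0l ?add0r; last exact: aug_diff.
by rewrite tensor_map0r ?scaler0 //; exact: aug_diff.
Qed.
Definition tensor_aug : augmentation tensor_complex (tensor A B) :=
  Augmentation tensor_aug_diff.
End Augmentation.

(* The component E_i ⊗ K_j -> D_n of a chain map out of E ⊗ K, of interest    *)
(* when i + j = n; stating it for any n spares transports between the equal   *)
(* but not convertible indices i + j and j + i.                               *)
Definition component (D : complex S) (f : chain_map tensor_complex D)
    (i j n : nat) : {linear tensor (E i) (K j) -> D n} :=
  f n \o @tot_incl S E K n i j.

End TensorComplex.

Section TensorWithModule.
Variables (S : comPzRingType) (N : lmodType S) (C : complex S).

Fact tensor_module_diff i x :
  tensor_map (B' := C i) (idfun : {linear N -> N}) (diff C i)
    (tensor_map idfun (diff C i.+1) x) = 0.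
Proof. by rewrite tensor_map_comp tensor_map0r //; exact: diff_diff. Qed.

Definition tensor_module : complex S :=
  @Complex S (fun i => tensor N (C i)) (fun i => tensor_map idfun (diff C i))
    tensor_module_diff.

Variables (M : lmodType S) (eps : augmentation C M).
Fact tensor_module_aug_diff x :
  (tensor_map idfun eps : {linear tensor N (C 0%N) -> tensor N M})
    (diff tensor_module 0 x) = 0.
Proof.
rewrite [LHS]tensor_map_comp tensor_map0r //; exact: aug_diff.
Qed.
Definition tensor_module_aug : augmentation tensor_module (tensor N M) :=
  Augmentation tensor_module_aug_diff.
End TensorWithModule.

(* Tor^S(N, M) computed from the given free resolution of M. *)
Definition Tor (S : comPzRingType) (N M : lmodType S) (C : complex S)
    (eps : augmentation C M) of is_free_resolution eps := fun n : nat =>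
  homology (tensor_module N C) n.

Section QuotientModule.
Variables (S : comPzRingType) (I : ideal S).

Definition quot_mod : lmodType S := restr (rproj I) (quotr I)^o.

Fact rproj_linear : linear (fun x : S^o => rproj I x : quot_mod).
Proof. by move=> a x y; rewrite rmorphD rmorphM. Qed.
Definition rproj_lin : {linear S^o -> quot_mod} := mklin rproj_linear.

Variable M : lmodType (quotr I).
Definition under : lmodType S := restr (rproj I) M.

Definition act (r : quot_mod) (m : under) : under := (r : quotr I) *: (m : M).
Fact act_linl m : linear (act^~ m).
Proof. by move=> a x y; rewrite /act scalerDl -scalerA. Qed.
Fact act_linr r : linear (act r).
Proof.
move=> a x y; rewrite /act scalerDr; congr (_ + _).
by rewrite [LHS]scalerA mulrC -scalerA.
Qed.
Definition mult_map : {linear tensor quot_mod under -> under} :=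
  tensor_lift act_linl act_linr.

End QuotientModule.

(* The map K_j -> D_(j+c), k |-> f (g ⊗ k), for a generator g of E_c: the     *)
(* component E_c ⊗ K_j -> D_(j+c) once E_c is identified with S by g |-> 1.   *)
Definition top_component (S : comPzRingType) (E K D : complex S)
    (f : chain_map (tensor_complex E K) D) (c : nat) (g : E c) (j : nat) :
    {linear K j -> D (j + c)%N} :=
  component f c j (j + c)%N \o @pure S (E c) (K j) g.

(* Main.v *)
Require Import Defs.
From HB Require Import structures.
From mathcomp Require Import all_boot all_order all_algebra.
From mathcomp Require Import boolp.

(** Write c for the length of E, e0 for the generator of E_0 = S and g for the
generator of E_c.  Duality of the last differential with the first one says
that the differential of g has its coefficients in I ([dg_in_I]), so that
x |-> sigma(g ⊗ x) is, modulo I, a map of complexes up to sign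
([top_shift_map]).

For the isomorphism on homology, Tor_c(R, M) is computed in two ways from the
double complex E_i ⊗ K_j.  Its rows and columns are exact since the modules
are free, so a cycle of R ⊗ K_c and a cycle of E_c ⊗ M correspond when they
are the two ends of a zigzag running along the diagonal i + j = c, and a zigzag
with one end a boundary has the other end a boundary.  All of E_c ⊗ M consists
of cycles and, as E stops at c, none but zero is a boundary, which identifies
Tor_c(R, M) with E_c ⊗ M = M.  What remains is to recognise the zigzag that
starts at e0 ⊗ sigma(g ⊗ k), for k in K_0.

It comes from a single zigzag in E ⊗ E, independent of M and of sigma.  For
M = R the correspondence exchanges the two generators e0 ⊗ g and g ⊗ e0 up to
a scalar u; zigzags exist in both directions, so u is a unit modulo I
([swap_unit]).  For fixed k in K_0 the map x |-> sigma(x ⊗ k) from E to K is a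
map of complexes, and applying it to the second factor gives a zigzag in E ⊗ K
from e0 ⊗ sigma(g ⊗ k) to u (g ⊗ sigma(e0 ⊗ k)) ([top_zigzag]).  The latter
goes to u (g ⊗ m) in E_c ⊗ M, where m is the class of k, because sigma induces
the multiplication R ⊗ M -> M.  Up to the unit u, the map of the theorem is
thus inverse to the identification of Tor_c(R, M) with M. *)

Import GRing.Theory.
Local Open Scope ring_scope.

(** * Linear bijections and homology classes *)

Lemma lin_iso_of_bij (S : pzRingType) (A B : lmodType S) (f : {linear A -> B}) :
  injective f -> (forall y, exists x, f x = y) ->
  exists th : lin_iso A B, forall x, th x = f x.
Proof.
move=> finj /choice[h hK].
have hlin : linear h.
  by move=> a x y; apply: finj; rewrite linearP !hK.
have fK : cancel f (mklin hlin) by move=> x; apply: finj; rewrite /= hK.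
by exists (LinIso fK hK).
Qed.

Lemma hclass_eq (S : pzRingType) (C : complex S) m (z z' : cycles C m) :
  hclass C m z = hclass C m z' <->
  exists y, diff C m y = cycle_val z - cycle_val z'.
Proof.
split=> [/qproj_eq/asboolP//|h]; by apply/qproj_eq/asboolP.
Qed.

(** * Dual bases of free modules *)

Section DualBasis.
Context {S : comPzRingType} {A : lmodType S} {X : choiceType}.

(** Summing over every duplicate-free list that contains the support, rather
than over one list, lets two expansions be compared over a common list. *)
Definition expands (b : X -> A) (k : X -> S) (s : seq X) (a : A) : Prop :=
  (forall x, x \notin s -> k x = 0) /\
  (forall t, uniq t -> {subset s <= t} -> a = \sum_(x <- t) k x *: b x).

Context {b : X -> A} (hb : is_basis b).

Lemma expands_lin p k s a k' s' a' :
  expands b k s a -> expands b k' s' a' ->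
  expands b (fun x => p * k x + k' x) (s ++ s') (p *: a + a').
Proof.
move=> [k0 ka] [k0' ka']; split=> [x|t ut st].
  by rewrite mem_cat negb_or => /andP[/k0 -> /k0' ->]; rewrite mulr0 addr0.
have ss : {subset s <= t} by move=> x xs; apply: st; rewrite mem_cat xs.
have ss' : {subset s' <= t} by move=> x xs; apply: st; rewrite mem_cat xs orbT.
rewrite {1}(ka t ut ss) {1}(ka' t ut ss') scaler_sumr -big_split /=.
by apply: eq_bigr => x _; rewrite scalerDl scalerA.
Qed.

Lemma expands_unique k s k' s' a :
  expands b k s a -> expands b k' s' a -> k =1 k'.
Proof.
move=> [k0 ka] [k0' ka'] x; pose t := undup (s ++ s').
have ut : uniq t := undup_uniq _.
have ss : {subset s <= t} by move=> y ys; rewrite mem_undup mem_cat ys.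
have ss' : {subset s' <= t} by move=> y ys; rewrite mem_undup mem_cat ys orbT.
have [xt|xt] := boolP (x \in t); last first.
  rewrite k0 ?k0' //; first by apply: contra xt; exact: ss'.
  by apply: contra xt; exact: ss.
apply/eqP; rewrite -subr_eq0; apply/eqP.
apply: (hb.2 t (fun y => k y - k' y) ut _ x xt).
under eq_bigr => y _ do rewrite scalerBl.
by rewrite sumrB -(ka t ut ss) -(ka' t ut ss') subrr.
Qed.

Lemma expands_exists a : exists k s, expands b k s a.
Proof.
have [s [k ->]] := hb.1 a.
elim: s => [|y s [k' [s' IH]]].
  exists (fun=> 0), [::]; split=> // t _ _; rewrite big_nil big1 // => x _.
  by rewrite scale0r.
have ey : expands b (fun x => if x == y then 1 else 0) [:: y] (b y).
  split=> [x|t ut st]; first by rewrite inE => /negPf ->.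
  rewrite (bigD1_seq y) ?st ?mem_head //= eqxx scale1r big1 ?addr0 // => x.
  by move=> /negPf ->; rewrite scale0r.
exists (fun x => k y * (if x == y then 1 else 0) + k' x), ([:: y] ++ s').
by rewrite big_cons; exact: expands_lin.
Qed.

(** The coordinates are linear because they are unique.  The expansion they
give carries both the flatness of free modules and the description of the dual
of E_1. *)
Lemma dual_basis : exists c : X -> {linear A -> S^o}, forall a,
  exists s : seq X, forall t, uniq t -> {subset s <= t} ->
    a = \sum_(x <- t) c x a *: b x.
Proof.
have [k hk] := choice expands_exists.
have klin x : linear (fun a => k a x : S^o).
  move=> p a a'; have [s hs] := hk a; have [s' hs'] := hk a'.
  have [t ht] := hk (p *: a + a').
  exact: (expands_unique _ _ _ _ _ ht (expands_lin p _ _ _ _ _ _ hs hs') x).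
exists (fun x => mklin (klin x)) => a; have [s [_ hs]] := hk a.
by exists s.
Qed.

End DualBasis.

(** * Tensor products and flatness of free modules *)

Section Tensors.
Context {S : comPzRingType}.
Implicit Types A B F : lmodType S.

Lemma tensor_ind A B (P : tensor A B -> Prop) :
  (forall a b, P (a ⊗ b)) -> P 0 -> (forall t u, P t -> P u -> P (t + u)) ->
  forall t, P t.
Proof.
move=> Pp P0 PD t; rewrite -[t]treprK tclassE.
by elim/big_ind: _ => // p _; exact: Pp.
Qed.

Lemma pure0r A B (a : A) : a ⊗ (0 : B) = 0.
Proof. by rewrite -(scale0r (0 : B)) pureZr scale0r. Qed.

Lemma pure0l A B (b : B) : (0 : A) ⊗ b = 0.
Proof. by rewrite -(scale0r (0 : A)) pureZl scale0r. Qed.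

Lemma contract_linl A B (c : {linear B -> S^o}) b : linear (fun a : A => (c b : S) *: a).
Proof. by move=> p a a'; rewrite scalerDr !scalerA mulrC. Qed.

Lemma contract_linr A B (c : {linear B -> S^o}) (a : A) :
  linear (fun b => (c b : S) *: a).
Proof. by move=> p b b'; rewrite linearP scalerDl scalerA. Qed.

Definition contract A B (c : {linear B -> S^o}) : {linear tensor A B -> A} :=
  tensor_lift (contract_linl A B c) (contract_linr A B c).

Lemma contractE A B (c : {linear B -> S^o}) a b :
  contract A B c (a ⊗ b) = (c b : S) *: a.
Proof. exact: tensor_liftE. Qed.

Lemma contract_map A A' B (c : {linear B -> S^o}) (f : {linear A -> A'}) t :
  contract A' B c (tensor_map f idfun t) = f (contract A B c t).
Proof.
move: t; apply: tensor_ind => [a b| |t u]; last by rewrite !linearD => -> ->.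
  by rewrite tensor_mapE !contractE linearZ.
by rewrite !linear0.
Qed.

(** An element t expands over the basis of F with coefficients in A'.
Contraction commutes with maps of the left factor, so the coefficients of an
element of the kernel lie in the kernel of g, hence in the image of f. *)
Lemma tensor_free_exactl {A A' A'' F} (f : {linear A -> A'}) (g : {linear A' -> A''}) :
  is_free F -> (forall x, g x = 0 -> exists y, f y = x) ->
  forall t : tensor A' F, tensor_map g idfun t = 0 ->
  exists u, tensor_map f idfun u = t.
Proof.
move=> [X [b hb]] fg t t0; have [c hc] := dual_basis hb.
have [s hs] : exists s : seq X, forall r, uniq r -> {subset s <= r} ->
    t = \sum_(x <- r) contract A' F (c x) t ⊗ b x.
  move: {t0} t; apply: tensor_ind => [a y| |t u [s hs] [s' hs']].
  - have [s hs] := hc y; exists s => r ur sr.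
    rewrite {1}(hs r ur sr) linear_sum; apply: eq_bigr => x _.
    by rewrite contractE pureZl linearZ_LR.
  - exists [::] => r _ _; rewrite big1 // => x _.
    by rewrite linear0 pure0l.
  - exists (s ++ s') => r ur sr.
    have ss : {subset s <= r} by move=> x xs; apply: sr; rewrite mem_cat xs.
    have ss' : {subset s' <= r}.
      by move=> x xs; apply: sr; rewrite mem_cat xs orbT.
    rewrite {1}(hs r ur ss) {1}(hs' r ur ss') -big_split.
    by apply: eq_bigr => x _; rewrite linearD pureDl.
have hy x : exists y, f y = contract A' F (c x) t.
  by apply: fg; rewrite -contract_map t0 linear0.
have [y {}hy] := choice hy.
exists (\sum_(x <- undup s) y x ⊗ b x).
rewrite linear_sum [RHS](hs _ (undup_uniq s)); last by move=> x; rewrite mem_undup.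
by apply: eq_bigr => x _; rewrite tensor_mapE hy.
Qed.

Lemma swap_linl A B (b : B) : linear (fun a : A => b ⊗ a).
Proof. exact: linearP. Qed.

Lemma swap_linr A B (a : A) : linear (fun b : B => b ⊗ a).
Proof. by move=> p x y; rewrite pureDl pureZl. Qed.

Definition tensor_swap A B : {linear tensor A B -> tensor B A} :=
  tensor_lift (swap_linl A B) (swap_linr A B).

Lemma tensor_swapE A B (a : A) (b : B) : tensor_swap A B (a ⊗ b) = b ⊗ a.
Proof. exact: tensor_liftE. Qed.

Lemma tensor_swapK A B : cancel (tensor_swap A B) (tensor_swap B A).
Proof.
apply: tensor_ind => [a b| |t u]; last by rewrite !linearD => -> ->.
  by rewrite !tensor_swapE.
by rewrite !linear0.
Qed.

Lemma tensor_swap_map A A' B B' (f : {linear A -> A'}) (g : {linear B -> B'}) t :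
  tensor_swap A' B' (tensor_map f g t) = tensor_map g f (tensor_swap A B t).
Proof.
move: t; apply: tensor_ind => [a b| |t u]; last by rewrite !linearD => -> ->.
  by rewrite !(tensor_mapE, tensor_swapE).
by rewrite !linear0.
Qed.

Lemma tensor_free_exactr {A A' A'' F} (f : {linear A -> A'}) (g : {linear A' -> A''}) :
  is_free F -> (forall x, g x = 0 -> exists y, f y = x) ->
  forall t : tensor F A', tensor_map idfun g t = 0 ->
  exists u, tensor_map idfun f u = t.
Proof.
move=> hF fg t t0.
have [|u hu] := tensor_free_exactl f g hF fg (tensor_swap F A' t).
  by rewrite -tensor_swap_map t0 linear0.
by exists (tensor_swap _ _ u); rewrite -tensor_swap_map hu tensor_swapK.
Qed.

End Tensors.

(** * Zigzags in a double complex *)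

(** The two differentials commute, instead of anticommuting as in a total
complex; this saves all signs.  A zigzag is stored as a family over all (i, j)
although only the entries with i + j = m matter, which avoids transports
between indices and makes linear combinations and transposition immediate. *)
Section DoubleComplex.
Context {S : pzRingType} {A : nat -> nat -> lmodType S}.
Context (dh : forall i j, {linear A i.+1 j -> A i j}).
Context (dv : forall i j, {linear A i j.+1 -> A i j}).

Definition zigzag (m : nat) (z : forall i j, A i j) : Prop :=
  forall i j, (i + j.+1)%N = m -> dh i j (z i.+1 j) = dv i j (z i j.+1).

Lemma zigzag_sub m a z z' : zigzag m z -> zigzag m z' ->
  zigzag m (fun i j => z i j - a *: z' i j).
Proof.
by move=> hz hz' i j e; rewrite !linearB !linearZ_LR hz // hz'.
Qed.

Hypothesis dhdv : forall i j x, dh i j (dv i.+1 j x) = dv i j (dh i j.+1 x).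
Hypothesis dvdv : forall i j x, dv i j (dv i j.+1 x) = 0.
Hypothesis dh_exact :
  forall i j x, dh i j x = 0 -> exists y, dh i.+1 j y = x.

(** Each step has to solve dh x' = dv x.  The previous step makes dv x a
horizontal cycle, so exactness of the row gives x'. *)
Lemma zigzag_lift m (y : A 0 m.+1) a : dh 0 m a = dv 0 m y ->
  exists z, zigzag m.+1 z /\ z 0%N m.+1 = y.
Proof.
move=> hy.
have [Y Ym] : exists Y : forall j, A 0 j, Y m.+1 = y.
  exists (fun j => if pselect (m.+1 = j) is left e then ecast j (A 0 j) e y else 0).
  by case: pselect => // e; rewrite (eq_irrelevance e erefl).
(* Outside the diagonal the step may have no solution; the implication makes
   it total, hence a function that can be iterated. *)
have lift i j (x : A i j.+1) : exists x' : A i.+1 j,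
    (exists w, dh i j w = dv i j x) -> dh i j x' = dv i j x.
  have [[w hw]|nw] := pselect (exists w, dh i j w = dv i j x); last by exists 0.
  by exists w.
have {lift} [s hs] : exists s : forall i j, A i j.+1 -> A i.+1 j,
    forall i j x, (exists w, dh i j w = dv i j x) ->
    dh i j (s i j x) = dv i j x.
  exists (fun i j x => projT1 (cid (lift i j x))) => i j x.
  exact: (projT2 (cid (lift i j x))).
pose z := fix z i : forall j, A i j :=
  if i is i'.+1 then fun j => s i' j (z i' j.+1) else Y.
suff hz i j : (i + j.+1)%N = m.+1 -> exists w, dh i j w = dv i j (z i j.+1).
  by exists z; split=> // i j /hz; exact: hs.
elim: i j => [|i IH] j.
  by rewrite add0n => -[->]; exists a; rewrite /= Ym.
move=> e; apply: dh_exact.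
by rewrite dhdv /= hs ?dvdv //; apply: IH; rewrite addnS -e.
Qed.

(** If x = dh a + dv b and x' is the next entry, then dh x' = dv x = dh (dv a),
so x' - dv a is a horizontal boundary: a serves as the vertical part of x'. *)
Lemma zigzag_boundary m z : zigzag m z ->
  (exists a b, z 0%N m = dh 0 m a + dv 0 m b) ->
  exists a b, z m 0%N = dh m 0 a + dv m 0 b.
Proof.
move=> hz z0.
suff H i j : (i + j)%N = m -> exists a b, z i j = dh i j a + dv i j b.
  by apply: H; rewrite addn0.
elim: i j => [|i IH] j; first by rewrite add0n => ->.
move=> e; have {}e : (i + j.+1)%N = m by rewrite addnS.
have [a [b hab]] := IH _ e.
have [|w hw] := dh_exact i j (z i.+1 j - dv i.+1 j a).
  apply/eqP; rewrite linearB subr_eq0 dhdv hz // hab linearD dvdv addr0.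
  exact: eqxx.
by exists w, a; rewrite hw subrK.
Qed.

End DoubleComplex.

(** * Chain maps out of a tensor product of complexes *)

Section Components.
Context {S : comPzRingType} {E K D : complex S}.
Context (sigma : chain_map (tensor_complex E K) D).

Lemma tot_incl_neq {n i j i' j'} (t : tensor (E i) (K j)) (e : (i' + j')%N = n) :
  i != i' -> @tot_incl S E K n i j t i' j' e = 0.
Proof. by rewrite /= /tot_incl_fun; case: eqP. Qed.

Lemma componentE i j m t :
  component sigma i j m t = sigma m (@tot_incl S E K m i j t).
Proof. by []. Qed.

Lemma tot_linE n (u v : tot_obj E K n) a i j (e : (i + j)%N = n) :
  (u + a *: v) i j e = u i j e + a *: v i j e.
Proof. by []. Qed.

Lemma component_diff i j m x y : (i + j.+1)%N = m ->
  diff D m (component sigma i.+1 j.+1 m.+1 (x ⊗ y)) =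
    component sigma i j.+1 m (diff E i x ⊗ y)
    + (-1) ^+ i.+1 *: component sigma i.+1 j m (x ⊗ diff K j y).
Proof.
move=> em; rewrite !componentE -(cmap_diff sigma) -linearZ -linearD; congr (sigma m _).
apply: tot_ext => i' j' e'; rewrite tot_diffE tot_linE.
have [ei|ni] := eqVneq i i'.
  subst i'; have ej : j' = j.+1 by apply/eqP; rewrite -(eqn_add2l i) e' em.
  subst j'; rewrite !tot_incl_same tensor_mapE.
  by rewrite !(@tot_incl_neq _ i.+1) ?gtn_eqF // linear0 !scaler0.
have [ei|ni1] := eqVneq i.+1 i'.
  subst i'; have ej : j' = j.
    by apply/eqP; rewrite -(eqn_add2l i.+1) e' addSn -addnS em.
  subst j'; rewrite !tot_incl_same tensor_mapE.
  rewrite (@tot_incl_neq _ i.+1) ?ltn_eqF // linear0 add0r.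
  by rewrite (@tot_incl_neq _ i) ?ltn_eqF // add0r.
have ni2 : i.+1 != i'.+1 by rewrite eqSS.
rewrite (tot_incl_neq _ _ ni2) (tot_incl_neq _ _ ni).
by rewrite !(tot_incl_neq _ _ ni1) !linear0.
Qed.

(** The edge j = 0, where the differential of the tensor product has a single
term. *)
Lemma component_diff0 i x y :
  diff D i (component sigma i.+1 0 i.+1 (x ⊗ y)) =
    component sigma i 0 i (diff E i x ⊗ y).
Proof.
rewrite !componentE -(cmap_diff sigma); congr (sigma i _).
apply: tot_ext => i' j' e'; rewrite tot_diffE.
have [ei|ni] := eqVneq i i'.
  subst i'; have ej : j' = 0%N by apply/eqP; rewrite -(eqn_add2l i) e' addn0.
  subst j'; rewrite !tot_incl_same tensor_mapE.
  by rewrite !(@tot_incl_neq _ i.+1) ?gtn_eqF // linear0 !scaler0 addr0.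
rewrite !(@tot_incl_neq _ i) // tot_incl_neq ?eqSS // linear0 add0r.
have -> : @tot_incl S E K i.+1 i.+1 0 (x ⊗ y) i' j'.+1 (totr e') = 0.
  by rewrite /= /tot_incl_fun; case: eqP => // ei; case: eqP.
by rewrite linear0 scaler0.
Qed.

End Components.

(** * Tensor products with cyclic modules *)

Section CyclicModule.
Context {S : comPzRingType}.

Lemma cyclic_tensorP {A B : lmodType S} {g : A} :
  (forall x, exists s : S, x = s *: g) ->
  forall t : tensor A B, exists b, t = g ⊗ b.
Proof.
move=> hg; apply: tensor_ind => [a b| |t u [b ->] [b' ->]].
- by have [s ->] := hg a; exists (s *: b); rewrite pureZr pureZl.
- by exists 0; rewrite pure0r.
- by exists (b + b'); rewrite pureDr.
Qed.

Lemma pure_inj0 {A B : lmodType S} {g : A} (c : {linear A -> S^o}) :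
  c g = 1 -> forall b : B, g ⊗ b = 0 -> b = 0.
Proof.
move=> cg b gb0; rewrite -[b]scale1r -[in LHS]cg -contractE.
by rewrite -(tensor_swapE _ _ g b) gb0 !linear0.
Qed.

End CyclicModule.

Section QuotientRing.
Context {S : comPzRingType} (I : ideal S).
Local Notation R := (quot_mod I).
Local Notation one := (rone I : quot_mod I).

Lemma rproj0 a : rproj I a = 0 <-> (a : S^o) \in I.
Proof.
rewrite -(rmorph0 (rproj I)); split=> [/qproj_eq|h]; first by rewrite subr0.
by apply/qproj_eq; rewrite subr0.
Qed.

Lemma quot_scale_one a : a *: one = rproj I a.
Proof. by rewrite [LHS]rmulE mulr1. Qed.

Lemma quot_tensorP {B : lmodType S} (t : tensor R B) : exists b, t = one ⊗ b.
Proof.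
apply: cyclic_tensorP => r; exists (rrepr r).
by rewrite quot_scale_one rprojK.
Qed.

Lemma quot_pureZ (B : lmodType S) (r : R) a (b : B) :
  (a : S^o) \in I -> r ⊗ (a *: b) = 0.
Proof.
move=> aI; rewrite pureZr -pureZl.
have -> : a *: r = 0; last exact: pure0l.
rewrite -[r]rprojK [LHS]rmulE; apply/rproj0.
by rewrite mulrC; apply: rpredZ.
Qed.

End QuotientRing.

(** * The double complex of two resolutions *)

Section TensorDouble.
Context {S : comPzRingType} (E K : complex S).

Definition dh i j : {linear tensor (E i.+1) (K j) -> tensor (E i) (K j)} :=
  tensor_map (diff E i) idfun.
Definition dv i j : {linear tensor (E i) (K j.+1) -> tensor (E i) (K j)} :=
  tensor_map idfun (diff K j).

Lemma dh_dv i j t : dh i j (dv i.+1 j t) = dv i j (dh i j.+1 t).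
Proof. by rewrite !tensor_map_comp; exact: tensor_map_ext. Qed.

Lemma dh_dh i j t : dh i j (dh i.+1 j t) = 0.
Proof. by rewrite tensor_map_comp tensor_map0l //; exact: diff_diff. Qed.

Lemma dv_dv i j t : dv i j (dv i j.+1 t) = 0.
Proof. by rewrite tensor_map_comp tensor_map0r //; exact: diff_diff. Qed.

End TensorDouble.

Definition tensor_zigzag {S : comPzRingType} (E K : complex S) :=
  zigzag (A := fun i j => tensor (E i) (K j)) (dh E K) (dv E K).

Section Exact.
Context {S : comPzRingType} {E K : complex S} {P N : lmodType S}.
Context {epsE : augmentation E P} {epsK : augmentation K N}.

Section Rows.
Context (hE : is_resolution epsE) (Kfree : forall j, is_free (K j)).

Lemma dh_exact i j x : dh E K i j x = 0 -> exists y, dh E K i.+1 j y = x.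
Proof. exact: (tensor_free_exactl (diff E i.+1) (diff E i) (Kfree j) (diff_exact hE (i:=i))). Qed.

Lemma dh_aug_exact j x : tensor_map epsE idfun x = 0 ->
  exists y, dh E K 0 j y = x.
Proof. exact: (tensor_free_exactl _ _ (Kfree j) (aug_exact hE)). Qed.

Lemma row_lift {m} {y : tensor (E 0%N) (K m.+1)} {a} : dh E K 0 m a = dv E K 0 m y ->
  exists z, tensor_zigzag E K m.+1 z /\ z 0%N m.+1 = y.
Proof.
exact: (zigzag_lift (A := fun i j => tensor (E i) (K j)) (dh E K) (dv E K)
  (dh_dv E K) (dv_dv E K) dh_exact).
Qed.

Lemma row_boundary {m z} : tensor_zigzag E K m z ->
  (exists a b, z 0%N m = dh E K 0 m a + dv E K 0 m b) ->
  exists a b, z m 0%N = dh E K m 0 a + dv E K m 0 b.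
Proof.
exact: (zigzag_boundary (A := fun i j => tensor (E i) (K j)) (dh E K) (dv E K)
  (dh_dv E K) (dv_dv E K) dh_exact).
Qed.
End Rows.

Section Columns.
Context (hK : is_resolution epsK) (Efree : forall i, is_free (E i)).

Lemma dv_exact i j x : dv E K i j x = 0 -> exists y, dv E K i j.+1 y = x.
Proof. exact: (tensor_free_exactr (diff K j.+1) (diff K j) (Efree i) (diff_exact hK (i:=j))). Qed.

Lemma dv_aug_exact i x : tensor_map idfun epsK x = 0 ->
  exists y, dv E K i 0 y = x.
Proof. exact: (tensor_free_exactr _ _ (Efree i) (aug_exact hK)). Qed.

(** The column versions are the row versions for the transposed double
complex. *)
Lemma column_lift {m} {y : tensor (E m.+1) (K 0%N)} {b} :
  dv E K m 0 b = dh E K m 0 y ->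
  exists z, tensor_zigzag E K m.+1 z /\ z m.+1 0%N = y.
Proof.
move=> hy; have [z [hz <-]] := zigzag_lift (A := fun i j => tensor (E j) (K i))
  (fun i j => dv E K j i) (fun i j => dh E K j i)
  (fun i j x => esym (dh_dv E K j i x)) (fun i j => dh_dh E K j i)
  (fun i j => dv_exact j i) _ _ _ hy.
exists (fun i j => z j i); split=> // i j e.
by apply/esym/hz; rewrite addnC addSnnS.
Qed.

Lemma column_boundary {m z} : tensor_zigzag E K m z ->
  (exists a b, z m 0%N = dh E K m 0 a + dv E K m 0 b) ->
  exists a b, z 0%N m = dh E K 0 m a + dv E K 0 m b.
Proof.
move=> hz [a [b hab]].
have [||c [d hcd]] := zigzag_boundary (A := fun i j => tensor (E j) (K i))
  (fun i j => dv E K j i) (fun i j => dh E K j i)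
  (fun i j x => esym (dh_dv E K j i x)) (fun i j => dh_dh E K j i)
  (fun i j => dv_exact j i) m (fun i j => z j i).
- by move=> i j e; apply/esym/hz; rewrite addnC addSnnS.
- by exists b, a; rewrite hab addrC.
- by exists d, c; rewrite hcd addrC.
Qed.
End Columns.

End Exact.

(** * A resolution whose last differential is dual to the first *)

Section Main.
Context {S : comPzRingType} {I : ideal S} {n : nat}.
Context {E : complex S} {epsE : augmentation E (quot_mod I)}.
Context (hE : is_resolution epsE).
Context (hEfree : forall i, is_finite_free (E i)).
Context (hElen : forall i, (n.+1 < i)%N -> forall x : E i, x = 0).
Context (iota : lin_iso (E 0%N) S^o).
Context (hiota : forall x, epsE x = rproj_lin I (iota x)).
Context (phi : lin_iso (E n.+1) (dual (E 0%N))).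
Context (psi : lin_iso (E n) (dual (E 1%N))).
Context (hdual : forall x, psi (diff E n x) = dual_map (diff E 0) (phi x)).

Local Notation R := (quot_mod I).
Local Notation one := (rone I : quot_mod I).
Let e0 : E 0%N := bwd iota 1.
Let g : E n.+1 := bwd phi (fwd iota).

Let Efree i : is_free (E i).
Proof. by have [X [b hb]] := hEfree i; exists X, b. Qed.

Lemma e0_gen x : x = iota x *: e0.
Proof.
apply: (can_inj (fwdK iota)); rewrite linearZ_LR bwdK.
by rewrite [RHS]mulr1.
Qed.

Lemma eps_e0 : epsE e0 = one.
Proof. by rewrite hiota bwdK. Qed.

Lemma top_coord_linear :
  linear (fun x => (phi x : {linear E 0%N -> S^o}) e0 : S^o).
Proof. by move=> a x y; rewrite linearP. Qed.
Definition top_coord : {linear E n.+1 -> S^o} := mklin top_coord_linear.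

Lemma top_coord_g : top_coord g = 1.
Proof. by rewrite /= bwdK bwdK. Qed.

Lemma g_gen x : exists s : S, x = s *: g.
Proof.
exists (top_coord x); apply: (can_inj (fwdK phi)); rewrite linearZ_LR bwdK.
apply: lin_ext => y; rewrite [in LHS](e0_gen y) linearZ_LR.
exact: mulrC.
Qed.

(** Under the duality, the differential of g is the functional iota ∘ d_1 on
E_1.  It takes values in I, and E_1 has a finite basis, so it is a finite sum of
coordinate functionals with coefficients in I. *)
Lemma dg_in_I : exists (X : finType) (a : X -> S) (v : X -> E n),
  (forall x, (a x : S^o) \in I) /\ diff E n g = \sum_x a x *: v x.
Proof.
have [X [b hb]] := hEfree 1.
have [c hc] := dual_basis hb.
exists X, (fun x => iota (diff E 0 (b x))), (fun x => bwd psi (c x)); split.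
  move=> x; apply/rproj0; have := aug_diff epsE (b x).
  by rewrite hiota.
apply: (can_inj (fwdK psi)); rewrite hdual bwdK linear_sum.
under eq_bigr do rewrite linearZ_LR bwdK.
apply: lin_ext => y; have [s hs] := hc y.
have -> : (\sum_x (iota (diff E 0 (b x)) : S) *: (c x : dual (E 1)) : {linear E 1%N -> S^o}) y
  = \sum_x (iota (diff E 0 (b x)) : S) *: c x y.
  by elim/big_ind2: _ => // u u' v v' <- <-.
have hy : y = \sum_x c x y *: b x.
  by rewrite {1}(hs (enum X) (enum_uniq _)) ?big_enum // => x _; rewrite mem_enum.
rewrite {1}hy linear_sum; apply: eq_bigr => x _.
rewrite !linearZ_LR; exact: mulrC.
Qed.

Lemma pure_dg {B : lmodType S} (r : R) (h : {linear E n -> B}) :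
  r ⊗ h (diff E n g) = 0.
Proof.
have [X [a [v [aI ->]]]] := dg_in_I.
rewrite !linear_sum big1 // => x _.
by rewrite [h _]linearZ_LR; exact: quot_pureZ.
Qed.

Lemma dh_top {K : complex S} a : dh E K n.+1 0 a = 0.
Proof.
by apply: tensor_map0l => x; rewrite (hElen _ (ltnSn n.+1) x) linear0.
Qed.

(** Since dg lies in I E_{c-1}, both e0 ⊗ g and g ⊗ e0 can be the end of a
zigzag.  One starts at e0 ⊗ g and ends at u (g ⊗ e0), another ends at g ⊗ e0
and starts at v (e0 ⊗ g).  The second minus v times the first starts at 0, so
its end (1 - uv)(g ⊗ e0) is a boundary, and vanishes in E_c ⊗ R: hence
1 - uv lies in I. *)
Lemma swap_unit : exists (z : forall i j, tensor (E i) (E j)) (u v : S),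
  [/\ tensor_zigzag E E n.+1 z, z 0%N n.+1 = e0 ⊗ g,
      z n.+1 0%N = u *: (g ⊗ e0) & rproj I (u * v) = 1].
Proof.
have [a ha] : exists a, dh E E 0 n a = dv E E 0 n (e0 ⊗ g).
  apply: (dh_aug_exact hE Efree); rewrite !tensor_mapE.
  exact: (pure_dg _ idfun).
have [z [hz z0]] := row_lift hE Efree ha.
have [b hb] : exists b, dv E E n 0 b = dh E E n 0 (g ⊗ e0).
  apply: (dv_aug_exact hE Efree); rewrite !tensor_mapE eps_e0.
  by rewrite -tensor_swapE (pure_dg _ idfun) linear0.
have [z' [hz' z'0]] := column_lift hE Efree hb.
have [x hx] := cyclic_tensorP g_gen (z n.+1 0%N).
have [y hy] := cyclic_tensorP (fun x => ex_intro _ _ (e0_gen x)) (z' 0%N n.+1).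
have [v hv] := g_gen y.
exists z, (iota x), v; split=> //.
  by rewrite hx {1}(e0_gen x) pureZr.
pose w i j := z' i j - v *: z i j.
have hw : tensor_zigzag E E n.+1 w := zigzag_sub _ _ _ v _ _ hz' hz.
have [|c [d hcd]] := row_boundary hE Efree hw.
  by exists 0, 0; rewrite !linear0 addr0 /w hy hv z0 pureZr subrr.
have : tensor_map idfun epsE (w n.+1 0%N) = 0.
  by rewrite hcd dh_top add0r tensor_map_comp tensor_map0r //; exact: aug_diff.
rewrite /w z'0 hx {1}(e0_gen x) pureZr scalerA.
rewrite -[X in X - _]scale1r -scalerBl linearZ_LR tensor_mapE -pureZr eps_e0.
move=> /(pure_inj0 _ top_coord_g); rewrite quot_scale_one.
by rewrite rmorphB rmorph1 mulrC => /eqP; rewrite subr_eq0 => /eqP/esym.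
Qed.

(** * The top component of the action on a resolution *)

Context {M : lmodType (quotr I)} {K : complex S} {epsK : augmentation K (under M)}.
Context (hK : is_free_resolution epsK) (sigma : chain_map (tensor_complex E K) K).
Context (hsigma : forall h : homology (tensor_complex E K) 0,
    aug_H0 epsK (chain_homology_map sigma 0 h)
      = mult_map M (aug_H0 (tensor_aug epsE epsK) h)).

Let Kres := free_res_resolution hK.
Let Kfree := free_res_free hK.

Lemma under_scale1 (a : S) (m : under M) : rproj I a = 1 -> a *: m = m.
Proof. by move=> h; rewrite -[LHS]/(rproj I a *: (m : M)) h scale1r. Qed.

(** For a cycle k of K, as is every k in K_0, the maps x |-> sigma(x ⊗ k) form a
map of complexes from E to K without any sign. *)
Lemma slice_linear k i : linear (fun x : E i => component sigma i 0 i (x ⊗ k)).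
Proof. by move=> a x y; rewrite pureDl pureZl linearP. Qed.
Definition slice k i : {linear E i -> K i} := mklin (slice_linear k i).

Lemma slice_diff k i x : diff K i (slice k i.+1 x) = slice k i (diff E i x).
Proof. exact: component_diff0. Qed.

Lemma slice_aug k : epsK (slice k 0%N e0) = epsK k.
Proof.
pose t : tensor_complex E K 0%N := @tot_incl S E K 0 0 0 (e0 ⊗ k).
have tc : cycle_pred t by apply/eqP.
have := hsigma (hclass _ _ (Cycle tc)).
rewrite [chain_homology_map _ _ _]homology_mapE.
rewrite [LHS](qliftE (homology_lift0 (aug_diff epsK))).
have -> : aug_H0 (tensor_aug epsE epsK) (hclass (tensor_complex E K) 0 (Cycle tc))
   = tensor_map epsE epsK (t 0%N 0%N (erefl 0%N)).
  exact: (qliftE (homology_lift0 (aug_diff (tensor_aug epsE epsK)))).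
rewrite [t _ _ _]tot_incl_same tensor_mapE [mult_map M _]tensor_liftE eps_e0.
by rewrite /act scale1r => <-.
Qed.

(** The image of the zigzag of E ⊗ E under the identity of E tensored with the
map of complexes x |-> sigma(x ⊗ k). *)
Lemma top_zigzag : exists u v : S, rproj I (u * v) = 1 /\
  forall k, exists z : forall i j, tensor (E i) (K j),
    [/\ tensor_zigzag E K n.+1 z, z 0%N n.+1 = e0 ⊗ slice k n.+1 g &
        z n.+1 0%N = u *: (g ⊗ slice k 0%N e0)].
Proof.
have [z [u [v [hz z0 z1 uv]]]] := swap_unit.
exists u, v; split=> // k; exists (fun i j => tensor_map idfun (slice k j) (z i j)).
split; last 2 first.
- by rewrite z0 tensor_mapE.
- by rewrite z1 linearZ_LR tensor_mapE.
move=> i j e.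
transitivity (tensor_map idfun (slice k j) (dh E E i j (z i.+1 j))).
  by rewrite !tensor_map_comp; exact: tensor_map_ext.
rewrite hz // !tensor_map_comp; apply: tensor_map_ext => // x /=.
exact/esym/slice_diff.
Qed.

Lemma one_pure_eq0 j (y : K j) : one ⊗ y = 0 -> exists a, dh E K 0 j a = e0 ⊗ y.
Proof. by move=> y0; apply: (dh_aug_exact hE Kfree); rewrite tensor_mapE eps_e0. Qed.

(** Injectivity in homology: if the start of the zigzag of [top_zigzag] is a
boundary then so is its end, hence u (g ⊗ m) = 0 for the class m of k, and u acts
invertibly on M. *)
Lemma top_inj k b : one ⊗ slice k n.+1 g = one ⊗ diff K n.+1 b -> epsK k = 0.
Proof.
have [u [v [uv /(_ k)[z [hz z0 z1]]]]] := top_zigzag.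
move=> /eqP; rewrite -subr_eq0 -linearB => /eqP/one_pure_eq0[a ha].
have [|c [d hcd]] := row_boundary hE Kfree hz.
  exists a, (e0 ⊗ b); rewrite z0 ha tensor_mapE linearB.
  by rewrite [RHS]subrK.
have : tensor_map idfun epsK (z n.+1 0%N) = 0.
  by rewrite hcd dh_top add0r tensor_map_comp tensor_map0r //; exact: aug_diff.
rewrite z1 linearZ_LR tensor_mapE slice_aug -pureZr.
move=> /(pure_inj0 _ top_coord_g) uk0.
by rewrite -[LHS](under_scale1 (u * v) _ uv) mulrC -scalerA uk0 scaler0.
Qed.

(** Surjectivity in homology: a cycle w starts a zigzag ending at some g ⊗ k,
and v k starts one, through sigma, that ends at u v (g ⊗ sigma(e0 ⊗ k)).  The
two ends agree in E_c ⊗ M, so the difference of the two starts is a boundary. *)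
Lemma top_surj w : one ⊗ diff K n w = 0 ->
  exists k b, one ⊗ w = one ⊗ slice k n.+1 g + one ⊗ diff K n.+1 b.
Proof.
move=> /one_pure_eq0[a ha].
have {}ha : dh E K 0 n a = dv E K 0 n (e0 ⊗ w) by rewrite ha tensor_mapE.
have [y [hy y0]] := row_lift hE Kfree ha.
have [k hk] := cyclic_tensorP g_gen (y n.+1 0%N).
have [u [v [uv /(_ (v *: k))[z [hz z0 z1]]]]] := top_zigzag.
pose x i j := y i j - 1 *: z i j.
have hx : tensor_zigzag E K n.+1 x := zigzag_sub _ _ _ 1 _ _ hy hz.
have [|d [c hcd]] := column_boundary Kres Efree hx.
  have [|c hc] := dv_aug_exact Kres Efree n.+1 (x n.+1 0%N).
    apply/eqP; rewrite linearB subr_eq0 hk scale1r z1 -pureZr !tensor_mapE.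
    rewrite [epsK (u *: _)]linearZ_LR slice_aug [epsK (v *: _)]linearZ_LR scalerA.
    by rewrite under_scale1.
  by exists 0, c; rewrite linear0 add0r hc.
have [b hb] := cyclic_tensorP (fun x => ex_intro _ _ (e0_gen x)) c.
exists (v *: k), b.
have := congr1 (tensor_map epsE (idfun : {linear K n.+1 -> K n.+1})) hcd.
rewrite /x y0 z0 hb scale1r linearB linearD !tensor_map_comp.
rewrite [X in _ = X + _]tensor_map0l ?add0r; last exact: aug_diff.
rewrite !tensor_mapE /= eps_e0 => /eqP; rewrite subr_eq => /eqP ->.
exact: addrC.
Qed.

(** * The induced map on homology *)

Local Notation RK := (tensor_module (quot_mod I) K).

(** The remaining term sigma(dg ⊗ k) of the Leibniz rule dies modulo I. *)
Lemma top_component_diff j (k : K j.+1) :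
  one ⊗ top_component sigma g j (diff K j k) =
  (-1) ^+ n.+1 *: (one ⊗ diff K (j + n.+1) (top_component sigma g j.+1 k)).
Proof.
have e : (n + j.+1)%N = (j + n.+1)%N by rewrite addnC addSnnS.
have hlin : linear (fun x => component sigma n j.+1 (j + n.+1) (x ⊗ k)).
  by move=> a x y; rewrite pureDl pureZl linearP.
rewrite [diff K (j + n.+1) _](component_diff sigma _ _ _ g k e).
rewrite pureDr (pure_dg one (mklin hlin)) add0r.
by rewrite pureZr scalerA -expr2 sqrr_sign scale1r.
Qed.

Lemma top_component_diff0 (k : K 0%N) :
  one ⊗ diff K n (top_component sigma g 0 k) = 0.
Proof.
rewrite [diff K _ _](slice_diff k n g); exact: pure_dg.
Qed.

Lemma top_shift_map : exists f : shift_map n.+1 RK RK,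
  forall j (z : tensor (quot_mod I) (K j)),
    f j z = tensor_map idfun (top_component sigma g j) z.
Proof.
pose F j : {linear RK j -> RK (j + n.+1)%N} :=
  tensor_map idfun (top_component sigma g j).
have Fdiff j x : F j (diff RK j x)
    = (-1) ^+ n.+1 *: diff RK (j + n.+1) (F j.+1 x).
  have [k ->] := quot_tensorP I x.
  rewrite /F [diff RK j _]tensor_mapE tensor_mapE [LHS]top_component_diff.
  by rewrite [F j.+1 _]tensor_mapE [diff RK _ _]tensor_mapE.
have Fdiff0 x : diff_from RK n.+1 (F 0%N x) = 0.
  have [k ->] := quot_tensorP I x.
  rewrite [F _ _]tensor_mapE [LHS]tensor_mapE; exact: top_component_diff0.
by exists (ShiftMap Fdiff Fdiff0).
Qed.

Lemma homology_quotP m (h : homology RK m) :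
  exists k (hk : cycle_pred (C := RK) (n := m) (one ⊗ k)),
    h = hclass RK m (Cycle hk).
Proof.
rewrite -(qproj_repr h); case: (repr h) => z hz.
have [k ek] := quot_tensorP I z; subst z.
by exists k, hz.
Qed.

Local Notation H0_M :=
  (aug_H0 (aug_comp (mult_map M) (tensor_module_aug (quot_mod I) epsK))).

Lemma H0_ME k (hk : cycle_pred (C := RK) (n := 0) (one ⊗ k)) :
  H0_M (hclass RK 0 (Cycle hk)) = epsK k.
Proof.
rewrite [LHS](qliftE (homology_lift0 (aug_diff
  (aug_comp (mult_map M) (tensor_module_aug (quot_mod I) epsK))))).
rewrite -[LHS]/(mult_map M (tensor_map idfun epsK (one ⊗ k))).
rewrite tensor_mapE [LHS]tensor_liftE.
by rewrite /act scale1r.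
Qed.

Lemma H0_M_inj : injective H0_M.
Proof.
move=> h h'; have [k [hk ->]] := homology_quotP _ h.
have [k' [hk' ->]] := homology_quotP _ h'; rewrite !H0_ME => ek.
have [|b hb] := aug_exact Kres (x := k - k').
  by rewrite linearB ek subrr.
apply/hclass_eq; exists (one ⊗ b : RK 1).
by rewrite [LHS]tensor_mapE hb linearB.
Qed.

Lemma H0_M_surj m : exists h, H0_M h = m.
Proof.
have [k <-] := aug_surj Kres m.
have hk : cycle_pred (C := RK) (n := 0) (one ⊗ k) by apply/eqP.
by exists (hclass RK 0 (Cycle hk)); exact: H0_ME.
Qed.

Context (f : shift_map n.+1 RK RK).
Context (fE : forall j (z : tensor (quot_mod I) (K j)),
  f j z = tensor_map idfun (top_component sigma g j) z).

Lemma shift_oneE k : f 0%N (one ⊗ k) = one ⊗ slice k n.+1 g.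
Proof. by rewrite fE; exact: tensor_mapE. Qed.

Lemma shift_inj : injective (shift_homology_map f).
Proof.
suff H h : shift_homology_map f h = 0 -> h = 0.
  move=> h h' e; apply/eqP; rewrite -subr_eq0; apply/eqP/H.
  by rewrite linearB e subrr.
have [k [hk ->]] := homology_quotP _ h.
rewrite [shift_homology_map _ _]homology_mapE -(linear0 (hclass RK n.+1)).
move=> /hclass_eq[y]; have [b ->] := quot_tensorP I y.
rewrite subr0 [LHS]tensor_mapE [RHS]shift_oneE => /esym/top_inj k0.
by apply: H0_M_inj; rewrite linear0 H0_ME.
Qed.

Lemma shift_surj h' : exists h, shift_homology_map f h = h'.
Proof.
have [w [hw ->]] := homology_quotP _ h'.
have /top_surj[k [b hkb]] : one ⊗ diff K n w = 0.
  by move: (hw) => /eqP; rewrite [LHS]tensor_mapE.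
have hk : cycle_pred (C := RK) (n := 0) (one ⊗ k) by apply/eqP.
exists (hclass RK 0 (Cycle hk)).
rewrite [LHS]homology_mapE; apply/hclass_eq; exists (- (one ⊗ b) : RK n.+2).
rewrite linearN [diff _ _ _]tensor_mapE [X in _ = X - _]shift_oneE.
by rewrite /= hkb opprD addrA subrr add0r.
Qed.

Lemma H0_M_bij : bijective H0_M.
Proof.
have [h hK'] := choice H0_M_surj.
by exists h => x; [apply: H0_M_inj; rewrite hK' | exact: hK'].
Qed.

Lemma top_iso : exists theta : lin_iso (under M) (Tor (quot_mod I) hK n.+1),
  forall h : homology RK 0, theta (H0_M h) = shift_homology_map f h.
Proof.
have [eta etaE] := lin_iso_of_bij _ _ _ _ H0_M_inj H0_M_surj.
pose G : {linear under M -> Tor (quot_mod I) hK n.+1} :=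
  shift_homology_map f \o bwd eta.
have [||theta thetaE] := lin_iso_of_bij _ _ _ G.
- by move=> x y /shift_inj/(can_inj (bwdK eta)).
- move=> y; have [h <-] := shift_surj y; exists (eta h).
  by rewrite /G /= fwdK.
- by exists theta => h; rewrite thetaE -etaE /G /= fwdK.
Qed.

End Main.

(* The length c of the resolution is n.+1.  The identification E_0 = S is iota, *)
(* so that iota itself is the element of E_0^* = S corresponding to 1.         *)
Theorem theorem1p2 (S : comPzRingType) (I : ideal S)
  (hS : noetherian S) (hR : noetherian (quotr I))
  (n : nat)
  (E : complex S) (epsE : augmentation E (quot_mod I))
  (hE : is_resolution epsE)
  (hEfree : forall i, is_finite_free (E i))
  (hElen : forall i, (n.+1 < i)%N -> forall x : E i, x = 0)
  (iota : lin_iso (E 0%N) S^o)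
  (hiota : forall x, epsE x = rproj_lin I (iota x))
  (phi : lin_iso (E n.+1) (dual (E 0%N)))
  (psi : lin_iso (E n) (dual (E 1%N)))
  (hdual : forall x, psi (diff E n x) = dual_map (diff E 0) (phi x))
  (M : lmodType (quotr I))
  (K : complex S) (epsK : augmentation K (under M))
  (hK : is_free_resolution epsK)
  (sigma : chain_map (tensor_complex E K) K)
  (hsigma : forall h : homology (tensor_complex E K) 0,
    aug_H0 epsK (chain_homology_map sigma 0 h)
      = mult_map M (aug_H0 (tensor_aug epsE epsK) h)) :
  let RK := tensor_module (quot_mod I) K in
  let g : E n.+1 := bwd phi (fwd iota) in
  let H0_M := aug_H0 (aug_comp (mult_map M) (tensor_module_aug (quot_mod I) epsK)) in
  exists f : shift_map n.+1 RK RK,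
    (forall j (z : tensor (quot_mod I) (K j)),
       f j z = tensor_map idfun (top_component sigma g j) z) /\
    bijective H0_M /\
    exists theta : lin_iso (under M) (Tor (quot_mod I) hK n.+1),
      forall h : homology RK 0, theta (H0_M h) = shift_homology_map f h.
Proof.
move=> RK g H0_M.
have [f fE] := top_shift_map hEfree iota hiota phi psi hdual sigma.
exists f; split; first exact: fE.
split; first exact: H0_M_bij hK.
exact: (top_iso hE hEfree hElen iota hiota phi psi hdual hK sigma hsigma f fE).
Qed.
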